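(* Let $L$ be the Rogers dilogarithm. For $n\geq 4$ let $(\mathrm{Eq}_n)$ denote the functional equation $$\sum_{\{i,j\}\in\chi_n} L(u_{i,j})=\frac{(n-3)(n-2)}{2}\,L(1),\qquad u_{i,j}=u_{i,j}(P),$$ for all points $P$ of the open standard cell $\Phi_n^{\circ}\subset\mathcal{M}_{0,n}(\mathbb{R})$. Then the family of equations $(\mathrm{Eq}_n)$, $n\neq 5$, is deduced from the five-term functional equation of $L$, namely $(\mathrm{Eq}_5)$: $$L(x)+L\!\left(\frac{1-x}{1-xy}\right)+L\!\left(\frac{1-y}{1-xy}\right)+L(y)+L(1-xy)=3L(1).$$
   Context: **Rogers dilogarithm.** $L(x)=\mathrm{Li}_2(x)+\frac12\log(x)\log(1-x)$ for $0<x<1$, where $\mathrm{Li}_2(x)=\sum_{k\ge1}x^k/k^2$, extended by $L(0)=0$ and $L(1)=\pi^2/6$. **Index set.** Indices are taken modulo $n$ in $\{1,\dots,n\}$. $\chi_n$ is the set of the $n(n-3)/2$ unordered pairs $\{i,j\}$ such that $i,\,i+1,\,j,\,j+1$ are pairwise distinct modulo $n$ (the strict chords of an $n$-gon with vertices numbered cyclically $1,\dots,n$). **Moduli space and dihedral coordinates.** $\mathcal{M}_{0,n}$ is the moduli space of genus $0$ curves with $n$ marked points, i.e. the space of $n$-tuples $(z_1,\dots,z_n)$ of distinct points of $\mathbb{P}^1$ modulo the diagonal action of $\mathrm{PSL}_2$. For $\{i,j\}\in\chi_n$ the dihedral coordinate $u_{i,j}=u_{j,i}$ is the cross-ratio $$u_{i,j}=\frac{(z_i-z_{j+1})(z_{i+1}-z_j)}{(z_i-z_j)(z_{i+1}-z_{j+1})}.$$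 **Standard cell.** $\Phi_n^{\circ}$ is the connected component of $\mathcal{M}_{0,n}(\mathbb{R})$ for which the marked points are in the natural cyclic order $z_1<z_2<\cdots<z_n<z_1$ on the circle $\mathbb{P}^1(\mathbb{R})$. On it all $u_{i,j}$ lie in $(0,1)$. **Case $n=5$.** With $x=u_{1,3}$ and $y=u_{1,4}$, one has $u_{2,4}=\frac{1-x}{1-xy}$, $u_{3,5}=\frac{1-y}{1-xy}$, $u_{2,5}=1-xy$, so that $(\mathrm{Eq}_5)$ is exactly the five-term equation displayed in the claim. *)

(* Defs.v *)
From mathcomp Require Import all_boot all_order all_algebra.
From mathcomp Require Import ring.
From mathcomp Require Import all_classical all_reals all_analysis.

Set Implicit Arguments.
Unset Strict Implicit.
Unset Printing Implicit Defensive.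

Import Order.TTheory GRing.Theory Num.Theory.
Import numFieldNormedType.Exports.

Local Open Scope classical_set_scope.
Local Open Scope ring_scope.

Definition Li2 {R : realType} (x : R) : R :=
  limn (series (fun k : nat => x ^+ k.+1 / k.+1%:R ^+ 2)).

(* Only the values on [0, 1] are meaningful. *)
Definition rogersL {R : realType} (x : R) : R :=
  if x == 0 then 0
  else if x == 1 then pi ^+ 2 / 6
  else Li2 x + 2^-1 * (ln x * ln (1 - x)).

(* The real projective line: Some t is the affine point t, None is infinity. *)
Definition P1 (R : realType) : Type := option R.

(* The determinant of the homogeneous coordinates (t : 1) of Some t and (1 : 0)
   of None. On affine points it is the difference; a cross-ratio is unchanged
   when differences are replaced by these determinants, and it then makes sense
   when one of the points is infinity. *)
Definition bracket {R : realType} (a b : P1 R) : R :=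
  match a, b with
  | Some s, Some t => s - t
  | Some _, None => -1
  | None, Some _ => 1
  | None, None => 0
  end.

(* The circle P^1(R) cut open at infinity, which is made the largest point. *)
Definition P1_lt {R : realType} (a b : P1 R) : bool :=
  match a, b with
  | Some s, Some t => s < t
  | Some _, None => true
  | None, _ => false
  end.

(* The cyclic order a < b < c < a on the circle. *)
Definition cyclic3 {R : realType} (a b c : P1 R) : bool :=
  [|| P1_lt a b && P1_lt b c, P1_lt b c && P1_lt c a | P1_lt c a && P1_lt a b].

(* z_1 < z_2 < ... < z_n < z_1 on the circle: every three of the points, taken
   in the order of their labels, are cyclically ordered; in particular the
   points are distinct when n >= 3. The points of the open standard cell are
   the classes modulo PSL_2 of these configurations. *)
Definition std_cell {R : realType} (n : nat) (z : 'I_n -> P1 R) : Prop :=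
  forall i j k : 'I_n, (i < j < k)%N -> cyclic3 (z i) (z j) (z k).

(* Labels 1, ..., n are shifted to 0, ..., n - 1, and ordS is the cyclic
   successor, so that ordS i stands for i + 1 modulo n. *)
Definition dihedral {R : realType} (n : nat) (z : 'I_n -> P1 R) (i j : 'I_n) : R :=
  (bracket (z i) (z (ordS j)) * bracket (z (ordS i)) (z j)) /
  (bracket (z i) (z j) * bracket (z (ordS i)) (z (ordS j))).

(* An unordered pair {i, j} is represented by (i, j) with i < j. *)
Definition chi (n : nat) : {set 'I_n * 'I_n} :=
  [set p : 'I_n * 'I_n |
    (p.1 < p.2)%N && uniq [:: p.1; ordS p.1; p.2; ordS p.2]].

(* The equation (Eq_n) for a function f in the place of L; the group A of values
   is arbitrary, and x *+ m is the sum of m copies of x. *)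
Definition dilog_eq {R : realType} {A : zmodType} (n : nat) (f : R -> A) : Prop :=
  forall z : 'I_n -> P1 R, std_cell z ->
    \sum_(p in chi n) f (dihedral z p.1 p.2) = f 1 *+ ((n - 3) * (n - 2))./2.

Definition five_term {R : realType} {A : zmodType} (f : R -> A) : Prop :=
  forall x y : R, 0 < x < 1 -> 0 < y < 1 ->
    f x + f ((1 - x) / (1 - x * y)) + f ((1 - y) / (1 - x * y)) + f y
      + f (1 - x * y) = f 1 *+ 3.

(* (Eq_n) is a formal consequence of (Eq_5): it holds for every solution f of
   (Eq_5), whatever the Hausdorff topological abelian group of its values, that
   is continuous on [0, 1] and vanishes at 0. Nothing else about the Rogers
   dilogarithm can enter the deduction. Continuity up to the end points is
   needed because (Eq_5) is stated on the open cell only: a constant function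
   on (0, 1), with a suitable other value at 1, satisfies (Eq_5) but not
   (Eq_4). *)
Definition deduced_from_Eq5 (R : realType) (n : nat) : Prop :=
  forall (A : topologicalZmodType) (f : R -> A),
    hausdorff_space A ->
    {within `[0, 1], continuous f} ->
    f 0 = 0 ->
    dilog_eq 5 f -> dilog_eq n f.

Definition mobius {R : realType} (a b c d : R) (p : P1 R) : P1 R :=
  match p with
  | Some t => if c * t + d == 0 then None else Some ((a * t + b) / (c * t + d))
  | None => if c == 0 then None else Some (a / c)
  end.

(* The dihedral coordinates depend only on the class of a configuration
   in M_{0,n}. *)
Lemma dihedral_mobius (R : realType) (n : nat) (z : 'I_n -> P1 R) (i j : 'I_n)
    (a b c d : R) :
  a * d - b * c != 0 ->
  dihedral (fun k => mobius a b c d (z k)) i j = dihedral z i j.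
Proof.
move=> D0.
pose w (p : P1 R) := match p with
  | Some t => if c * t + d == 0 then a * t + b else c * t + d
  | None => if c == 0 then a else c end.
have w0 p : w p != 0.
  case: p => [t|] /=; case: ifPn => //.
    move=> /eqP e; apply/eqP => e'; case/eqP: D0.
    have -> : d = - (c * t) by apply/eqP; rewrite -addr_eq0 addrC e.
    have -> : b = - (a * t) by apply/eqP; rewrite -addr_eq0 addrC e'.
    by ring.
  by move=> /eqP c0; apply/eqP => a0; case/eqP: D0; rewrite c0 a0; ring.
have key p q : bracket p q =
    w p * w q * bracket (mobius a b c d p) (mobius a b c d q) / (a * d - b * c).
  apply: (mulIf D0); rewrite divfK //; case: p q => [s|] [t|] /=.
  - case: ifPn => [/eqP es|s0]; case: ifPn => [/eqP et|t0] /=.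
    + have -> : d = - (c * s) by apply/eqP; rewrite -addr_eq0 addrC es.
      rewrite mulr0; have e : c * (s - t) = 0.
        by rewrite mulrBr -(subrr (c * s + d)) {2}es -et; ring.
      by rewrite -[RHS](mulr0 (- (a * s + b))) -e; ring.
    + have -> : d = - (c * s) by apply/eqP; rewrite -addr_eq0 addrC es.
      by ring.
    + have -> : d = - (c * t) by apply/eqP; rewrite -addr_eq0 addrC et.
      by ring.
    + by field; rewrite s0 t0.
  - case: ifPn => [/eqP es|s0]; case: ifPn => [/eqP c0|c0] /=.
    + have d0 : d = 0 by rewrite -es c0; ring.
      by rewrite c0 d0; ring.
    + have -> : d = - (c * s) by apply/eqP; rewrite -addr_eq0 addrC es.
      by ring.
    + by rewrite c0; ring.
    + by field; rewrite s0 c0.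
  - case: ifPn => [/eqP c0|c0]; case: ifPn => [/eqP es|s0] /=.
    + have d0 : d = 0 by rewrite -es c0; ring.
      by rewrite c0 d0; ring.
    + by rewrite c0; ring.
    + have -> : d = - (c * t) by apply/eqP; rewrite -addr_eq0 addrC es.
      by ring.
    + by field; rewrite s0 c0.
  - by case: ifPn => [/eqP c0|c0] /=; rewrite ?subrr; ring.
have key2 p q r t : bracket p q * bracket r t =
    (w p * w q * (w r * w t) / (a * d - b * c) ^+ 2) *
    (bracket (mobius a b c d p) (mobius a b c d q) *
     bracket (mobius a b c d r) (mobius a b c d t)).
  by rewrite (key p) (key r) expr2 invfM; ring.
rewrite /dihedral [in RHS]key2 [in X in _ = _ / X]key2.
set k := (X in _ = X * _ / _); set k' := (X in _ = _ / (X * _)).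
have k0 : k != 0 by rewrite /k !mulf_neq0 ?invr_eq0 ?expf_neq0.
have <- : k = k' by rewrite /k /k'; ring.
by rewrite -[RHS]mulf_div divff // mul1r.
Qed.

(* Main.v *)
(** Letting y tend to 0 in the five-term equation gives the reflection equation
    f x + f (1 - x) = f 1. Hence h = f 1 - f u, for u the cross-ratio of four
    cyclically ordered points, changes to f 1 - h when the points are rotated,
    and the five-term equation says that h is a 3-cocycle on the ordered points
    z_0, ..., z_m, where n = m + 1. The chords {i, j} with j < m contribute
    f 1 - h (i, i+1, j, j+1), the chords {i, m} contribute h (0, i, i+1, m), and
    the cocycle relations of the simplices (0, i, i+1, m, m+1) show by induction
    on m that all the h terms cancel. For the Rogers dilogarithm what remains is
    continuity on [0, 1]. *)
Require Import Defs.
From mathcomp Require Import all_boot all_order all_algebra.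
From mathcomp Require Import ring lra zify.
From mathcomp Require Import all_classical all_reals all_analysis.

Set Implicit Arguments.
Unset Strict Implicit.
Unset Printing Implicit Defensive.

Import Order.TTheory GRing.Theory Num.Theory.
Import numFieldNormedType.Exports.

Local Open Scope classical_set_scope.
Local Open Scope ring_scope.

(** * Enumeration of the strict chords *)

Lemma sum_chi (A : zmodType) (G : nat -> nat -> A) (m : nat) : (2 < m)%N ->
  \sum_(p in chi m.+1) G p.1 p.2 =
  \sum_(0 <= j < m) \sum_(0 <= i < j.-1) G i j + \sum_(1 <= i < m.-1) G i m.
Proof.
move=> m2.
(* With labels [0, ..., m] only [ordS m = 0] wraps around, so among the pairs with [i + 1 < j]
   exactly [(0, m)] fails to be a strict chord. Hence the last column starts at [1]. *)
have chiE (i j : 'I_m.+1) : ((i, j) \in chi m.+1) =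
    (i.+1 < j)%N && ~~ ((i == 0 :> nat) && (j == m :> nat)).
  rewrite inE /= !inE -!(inj_eq val_inj) /=.
  have := ltn_ord i; have := ltn_ord j; rewrite !ltnS => jm im.
  have [ij|//] := ltnP i j; last by lia.
  have -> : (i.+1 %% m.+1 = i.+1)%N by rewrite modn_small // ltnS (leq_trans ij).
  case: (ltngtP j m) jm => // [jm|->] _; last by rewrite modnn; lia.
  by rewrite modn_small //; lia.
rewrite (eq_bigl (fun p : 'I_m.+1 * 'I_m.+1 => true && ((p.1, p.2) \in chi m.+1)));
  last by case.
rewrite -(pair_big_dep xpredT (fun i j : 'I_m.+1 => (i, j) \in chi m.+1)
  (fun i j : 'I_m.+1 => G i j)) /=.
under eq_bigr do (under eq_bigl do rewrite chiE).
rewrite (exchange_big_dep xpredT) //=.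
under eq_bigr => j _.
  rewrite -(big_mkord (fun i => (i.+1 < j)%N && ~~ ((i == 0 :> nat) && (j == m :> nat)))
    (fun i => G i j)).
  over.
rewrite -(big_mkord xpredT (fun j => \sum_(0 <= i < m.+1 |
  (i.+1 < j)%N && ~~ ((i == 0 :> nat) && (j == m :> nat))) G i j)).
rewrite big_nat_recr //=; congr (_ + _).
  apply: eq_big_nat => j /andP[_ jm].
  rewrite [RHS](big_nat_widen _ _ m.+1) /=; last by lia.
  by apply: eq_bigl => i; lia.
rewrite (big_nat_widen 1 _ m.+1) /=; last by lia.
rewrite [LHS]big_ltn_cond // eqxx /= andbF.
rewrite big_nat_cond [RHS]big_nat_cond; apply: eq_bigl => i.
by lia.
Qed.

(** There are [(m - 1)(m - 2) / 2] pairs with [i + 1 < j < m], so the columns below [m] alone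
    account for the right-hand side of (Eq_n), [n = m + 1]. *)
Lemma sum_triangle (A : zmodType) (c : A) (m : nat) : (0 < m)%N ->
  \sum_(0 <= j < m) \sum_(0 <= i < j.-1) c = c *+ ((m.+1 - 3) * (m.+1 - 2))./2.
Proof.
case: m => // m _; elim: m => [|m IH].
  by rewrite big_nat1 big_geq.
rewrite big_nat_recr //= IH big_const_nat iter_addr_0 -mulrnDr subn0.
congr (_ *+ _); case: m {IH} => // m.
by rewrite !subSS !subn0 /=; lia.
Qed.

(** * Cancellation by the cocycle relation *)

Section Cocycle.

Variables (A : zmodType) (h : nat -> nat -> nat -> nat -> A) (N : nat).

(* The alternating sum of [h] over the boundary of a 4-simplex is zero; the
   terms are moved so that no sign occurs. *)
Hypothesis h_cocycle : forall a b c d e : nat,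
  (a < b < c)%N -> (c < d < e)%N -> (e <= N)%N ->
  h b c d e + h a b d e + h a b c d = h a c d e + h a b c e.

(** Sum of the cocycle relations of [(0, i, i+1, m, m+1)] for [1 <= i <= k]: the faces
    [(0, i, m, m+1)] telescope. *)
Let cone_column (m k : nat) : (k.+1 < m < N)%N ->
  \sum_(0 <= i < k.+1) h i i.+1 m m.+1 + \sum_(1 <= i < k.+1) h 0 i i.+1 m =
  h 0 k.+1 m m.+1 + \sum_(1 <= i < k.+1) h 0 i i.+1 m.+1.
Proof.
elim: k => [|k IH] km; first by rewrite big_nat1 !big_geq.
rewrite big_nat_recr //= [\sum_(1 <= i < k.+2) h 0 i i.+1 m]big_nat_recr //=.
rewrite [\sum_(1 <= i < k.+2) h 0 i i.+1 m.+1]big_nat_recr //=.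
rewrite addrACA IH; last by lia.
rewrite [RHS]addrCA -h_cocycle; [|lia..].
rewrite [X in X + _]addrC -addrA; congr (_ + _).
by rewrite addrA [X in X + _]addrC.
Qed.

(** Passing from [m] to [m + 1] adds column [m], to which [cone_column] applies with [k = m - 2];
    the leftover face [(0, m-1, m, m+1)] is the last term of the new sum. *)
Lemma sum_strips (m : nat) : (m <= N)%N ->
  \sum_(0 <= j < m) \sum_(0 <= i < j.-1) h i i.+1 j j.+1 =
  \sum_(1 <= i < m.-1) h 0 i i.+1 m.
Proof.
elim: m => [|m IH] mN; first by rewrite !big_geq.
rewrite big_nat_recr //= IH; last exact: ltnW.
case: m {IH} mN => [|[|m]] mN; rewrite ?[m.+2.-1]/=; try by rewrite !big_geq // addr0.
by rewrite addrC cone_column ?ltnSn //= [RHS]big_nat_recr //= addrC.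
Qed.

End Cocycle.

(** * Cross-ratios of cyclically ordered points *)

Section CrossRatio.

Variable R : realType.
Implicit Types a b c d e : P1 R.

(** This is [u_{i,j}] at [z_i, z_{i+1}, z_j, z_{j+1}]; the cocycle also needs it at points whose
    labels are not adjacent. *)
Definition cross_ratio a b c d : R :=
  (bracket a d * bracket b c) / (bracket a c * bracket b d).

Lemma cyclic3_rot a b c : cyclic3 b c a = cyclic3 a b c.
Proof. by rewrite /cyclic3 orbA orbC orbA. Qed.

Lemma bracketC a b : bracket a b = - bracket b a.
Proof. by case: a b => [s|] [t|] /=; ring. Qed.

(** Each point occurs twice in the product, so its sign is independent of the homogeneous
    coordinates and records the orientation of the triple. *)
Lemma cyclic3_bracket a b c : cyclic3 a b c ->
  0 < bracket a b * bracket b c * bracket c a.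
Proof.
have ord (s t u : R) : s < t -> t < u -> 0 < (s - t) * (t - u) * (u - s).
  move=> st tu; rewrite mulr_gt0 ?subr_gt0 ?(lt_trans st) //.
  by rewrite nmulr_rgt0 subr_lt0.
rewrite /cyclic3; case: a b c => [s|] [t|] [u|] //=; rewrite ?andbF ?andbT ?orbF /=.
  case/or3P=> /andP[]; first exact: ord.
  - by move=> tu us; rewrite -mulrA mulrC ord.
  - by move=> us st; rewrite mulrC mulrA ord.
all: by move=> ?; lra.
Qed.

Lemma cyclic3_neq0 a b c : cyclic3 a b c ->
  [/\ bracket a b != 0, bracket b c != 0 & bracket a c != 0].
Proof.
move=> /cyclic3_bracket /lt0r_neq0; rewrite !mulf_eq0 !negb_or.
by rewrite [bracket a c]bracketC oppr_eq0 => /andP[/andP[]].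
Qed.

Definition cyclic4 a b c d :=
  [&& cyclic3 a b c, cyclic3 a b d, cyclic3 a c d & cyclic3 b c d].

Lemma cyclic4_rot a b c d : cyclic4 a b c d -> cyclic4 b c d a.
Proof.
by case/and4P=> abc abd acd bcd; apply/and4P; split=> //; rewrite cyclic3_rot.
Qed.

Lemma plucker a b c d : bracket a c * bracket b d =
  bracket a b * bracket c d + bracket a d * bracket b c.
Proof. by case: a b c d => [s|] [t|] [u|] [v|] /=; ring. Qed.

(** The Plücker relation divided by [bracket a c * bracket b d]. *)
Lemma cross_ratio_rot a b c d : bracket a c != 0 -> bracket b d != 0 ->
  cross_ratio b c d a = 1 - cross_ratio a b c d.
Proof.
move=> ac bd; rewrite /cross_ratio -[1](@divff _ (bracket a c * bracket b d)) ?mulf_neq0 //.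
rewrite -mulrBl {1}(plucker a b c d) addrK [bracket b a]bracketC [bracket c a]bracketC.
by field; rewrite ac bd.
Qed.

(** The positive products of [(a, b, c)] and [(a, b, d)] multiply to [bracket a b ^+ 2] times
    numerator times denominator, which is the cross-ratio up to a square. *)
Lemma cross_ratio_gt0 a b c d : cyclic4 a b c d -> 0 < cross_ratio a b c d.
Proof.
case/and4P=> /cyclic3_bracket abc /cyclic3_bracket abd _ _.
rewrite /cross_ratio; set p := bracket a d * _; set q := bracket a c * _.
have pq : 0 < bracket a b ^+ 2 * (p * q).
  suff <- : bracket a b * bracket b c * bracket c a *
    (bracket a b * bracket b d * bracket d a) = bracket a b ^+ 2 * (p * q).
    exact: mulr_gt0.
  by rewrite /p /q [bracket d a]bracketC [bracket c a]bracketC; ring.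
have q0 : q != 0 by apply: contraTneq pq => ->; rewrite !mulr0 ltxx.
have ab0 : bracket a b != 0 by apply: contraTneq abc => ->; rewrite !mul0r ltxx.
have -> : p / q = bracket a b ^+ 2 * (p * q) / (bracket a b * q) ^+ 2.
  by field; rewrite ab0 q0.
by rewrite divr_gt0 // exprn_even_gt0 //= mulf_neq0.
Qed.

(** The upper bound is the positivity of the rotated cross-ratio [1 - u]. *)
Lemma cross_ratio01 a b c d : cyclic4 a b c d -> 0 < cross_ratio a b c d < 1.
Proof.
move=> abcd; rewrite cross_ratio_gt0 //=.
have /cyclic4_rot/cross_ratio_gt0 := abcd.
case/and4P: abcd => /cyclic3_neq0[_ _ ac] _ _ /cyclic3_neq0[_ _ bd].
by rewrite cross_ratio_rot // subr_gt0.
Qed.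

(* x and y are u_{1,3} and u_{1,4} when a, b, c, d, e are z_1, ..., z_5. *)
Lemma cross_ratio_five a b c d e :
  cyclic4 a b c d -> cyclic4 a b d e -> cyclic3 c d e ->
  let x := cross_ratio a b c d in let y := cross_ratio a b d e in
  [/\ cross_ratio b c d e = (1 - x) / (1 - x * y),
      cross_ratio c d e a = (1 - y) / (1 - x * y)
    & cross_ratio b c e a = 1 - x * y].
Proof.
move=> abcd abde /cyclic3_neq0[_ _ ce].
have /andP[x0 x1] := cross_ratio01 abcd; have /andP[y0 y1] := cross_ratio01 abde.
case/and4P: (abcd) => /cyclic3_neq0[_ _ ac] /cyclic3_neq0[_ bd ad] _ _.
case/and4P: (abde) => _ /cyclic3_neq0[_ be ae] _ _.
move=> x y.
(* Cross-ratios multiply when the second pair is subdivided, here [(c, e)] at [d]; so [1 - x * y] is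
   again a rotated cross-ratio. *)
have xy : x * y = cross_ratio a b c e.
  by rewrite /x /y /cross_ratio; field; rewrite ac bd be ad.
have xy1 : 1 - x * y != 0.
  by rewrite subr_eq0 gt_eqF // mulr_ilt1 // ltW.
rewrite xy -cross_ratio_rot // in xy1 *.
rewrite -!cross_ratio_rot //.
(* With all differences from 1 rotated, both identities are multiplicativity again: [(b,c,d,e)]
   times [(b,c,e,a)] is [(b,c,d,a)], and [(c,d,e,a)] times [(b,c,e,a)] is [(b,d,e,a)]. *)
split=> //; apply: (mulIf xy1); rewrite divfK //; rewrite /cross_ratio;
  rewrite ?[bracket c a]bracketC ?[bracket e a]bracketC ?[bracket d a]bracketC
    ?[bracket b a]bracketC;
  field; rewrite ?ac ?bd ?be ?ad ?ce ?ae //.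
Qed.

End CrossRatio.

(** * Dihedral coordinates of a point of the cell *)

Section Configuration.

Variables (R : realType) (m : nat) (z : 'I_m.+1 -> P1 R).
Hypothesis z_cell : std_cell z.

Let zn (k : nat) : P1 R := z (inord k).

Lemma std_cell_cyclic3 i j k : (i < j < k)%N -> (k <= m)%N ->
  cyclic3 (zn i) (zn j) (zn k).
Proof. by move=> ijk km; apply: z_cell; rewrite !inordK //; lia. Qed.

Lemma std_cell_cyclic4 i j k l : (i < j < k)%N -> (k < l <= m)%N ->
  cyclic4 (zn i) (zn j) (zn k) (zn l).
Proof. by move=> ijk kl; apply/and4P; split; apply: std_cell_cyclic3; lia. Qed.

Lemma dihedral_inner i j : (i < j < m)%N ->
  dihedral z (inord i) (inord j) = cross_ratio (zn i) (zn i.+1) (zn j) (zn j.+1).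
Proof.
move=> ijm; rewrite /dihedral /cross_ratio.
suff S k : (k < m)%N -> ordS (inord k : 'I_m.+1) = inord k.+1.
  by rewrite !S //; lia.
by move=> km; apply: val_inj; rewrite /= !inordK ?modn_small //; lia.
Qed.

Lemma dihedral_last i : (i < m)%N ->
  dihedral z (inord i) (inord m) = cross_ratio (zn i) (zn i.+1) (zn m) (zn 0).
Proof.
move=> im; rewrite /dihedral /cross_ratio.
have -> : ordS (inord m : 'I_m.+1) = inord 0.
  by apply: val_inj; rewrite /= !inordK ?modnn.
suff -> : ordS (inord i : 'I_m.+1) = inord i.+1 by [].
by apply: val_inj; rewrite /= !inordK ?modn_small //; lia.
Qed.

Lemma sum_dihedral (A : zmodType) (f : R -> A) : (2 < m)%N ->
  \sum_(p in chi m.+1) f (dihedral z p.1 p.2) =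
  \sum_(0 <= j < m) \sum_(0 <= i < j.-1)
     f (cross_ratio (zn i) (zn i.+1) (zn j) (zn j.+1)) +
  \sum_(1 <= i < m.-1) f (cross_ratio (zn i) (zn i.+1) (zn m) (zn 0)).
Proof.
move=> m2.
have -> : \sum_(p in chi m.+1) f (dihedral z p.1 p.2) =
    \sum_(p in chi m.+1) f (dihedral z (inord p.1) (inord p.2)).
  by apply: eq_bigr => p _; rewrite !inord_val.
rewrite (sum_chi (fun i j => f (dihedral z (inord i) (inord j)))) //.
congr (_ + _).
  apply: eq_big_nat => j /andP[_ jm]; apply: eq_big_nat => i ij.
  by rewrite dihedral_inner //; lia.
by apply: eq_big_nat => i im; rewrite dihedral_last //; lia.
Qed.

End Configuration.

Lemma sum_dihedral5 (R : realType) (A : zmodType) (f : R -> A) (z : 'I_5 -> P1 R) :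
  std_cell z ->
  let x := dihedral z (inord 0) (inord 2) in let y := dihedral z (inord 0) (inord 3) in
  0 < x < 1 /\ 0 < y < 1 /\
  \sum_(p in chi 5) f (dihedral z p.1 p.2) =
    f x + f ((1 - x) / (1 - x * y)) + f ((1 - y) / (1 - x * y)) + f y + f (1 - x * y).
Proof.
move=> zc x y; rewrite /x /y !dihedral_inner // sum_dihedral //.
have C i j k l := std_cell_cyclic4 zc (i := i) (j := j) (k := k) (l := l).
have /= [] := cross_ratio_five (C 0 1 2 3 isT isT)%N (C 0 1 3 4 isT isT)%N
   (std_cell_cyclic3 zc (i := 2%N) (j := 3%N) (k := 4%N) isT isT).
move=> <- <- <-; split; [|split]; try by apply/cross_ratio01/C.
(* The chords come column by column, in the order [x], [y], [(1,2,3,4)], [(1,2,4,0)], [(2,3,4,0)];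
   only a permutation of the five terms remains. *)
rewrite unlock /= !addr0 !add0r.
have perm (a b c d e : A) : a + (d + b) + (e + c) = a + b + c + d + e.
  by rewrite [d + b]addrC [e + c]addrC !addrA [a + b + d + c]addrAC.
exact: perm.
Qed.

(** * From the five-term equation to (Eq_n) *)

Lemma dilog_eq5P (R : realType) (A : zmodType) (f : R -> A) :
  dilog_eq 5 f <-> five_term f.
Proof.
(* A configuration yields a pair [(x, y)] in the open unit square; conversely every such pair must
   be realised by a configuration. *)
split=> [f5 x y x01 y01|ft z zc]; last first.
  by have [x01 [y01 ->]] := sum_dihedral5 f zc; exact: ft.
have [/andP[x0 x1] /andP[y0 y1]] := (x01, y01).
(* u_{1,3} = x and u_{1,4} = y for the points oo, 0, x y, y, 1. *)
pose z (k : 'I_5) : P1 R := nth None [:: None; Some 0; Some (x * y); Some y; Some 1] k.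
have zc : std_cell z.
  have xy0 : 0 < x * y by exact: mulr_gt0.
  have xyy : x * y < y by rewrite gtr_pMl.
  have xy1 : x * y < 1 by exact: lt_trans y1.
  move=> [[|[|[|[|[|i]]]]] ?] // [[|[|[|[|[|j]]]]] ?] // [[|[|[|[|[|k]]]]] ?] //= _;
    by rewrite /cyclic3 /= ?ltr01 ?y0 ?y1 ?xy0 ?xyy ?xy1.
have [_ [_]] := sum_dihedral5 f zc.
rewrite f5 // !dihedral_inner //= /cross_ratio /z !inordK //=.
have -> : 1 * (0 - x * y) / (1 * (0 - y)) = x by field; rewrite gt_eqF.
have -> : 1 * (0 - y) / (1 * (0 - 1)) = y by field.
by move=> <-.
Qed.

(** The algebraic core: topology enters only through the reflection equation, taken here as a
    hypothesis. *)
Lemma dilog_eq_of_five_term (R : realType) (A : zmodType) (f : R -> A) (m : nat) :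
  five_term f -> (forall x, 0 < x < 1 -> f x + f (1 - x) = f 1) -> (2 < m)%N ->
  dilog_eq m.+1 f.
Proof.
move=> ft f_refl m2 z zc.
pose zn (k : nat) := z (inord k).
(* 1 - u is a cyclic rotation of the cross-ratio u, so h is f 1 - f u; in these
   terms the five-term equation has no constant left and is a cocycle relation. *)
pose h a b c d := f (cross_ratio (zn b) (zn c) (zn d) (zn a)).
have gh a b c d : (a < b < c)%N -> (c < d <= m)%N ->
    f (cross_ratio (zn a) (zn b) (zn c) (zn d)) = f 1 - h a b c d.
  move=> abc cd; have abcd := std_cell_cyclic4 zc abc cd.
  rewrite -(f_refl _ (cross_ratio01 abcd)) /h.
  case/and4P: abcd => /cyclic3_neq0[_ _ ac] _ _ /cyclic3_neq0[_ _ bd].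
  by rewrite (cross_ratio_rot ac bd) addrK.
have h_cocycle a b c d e : (a < b < c)%N -> (c < d < e)%N -> (e <= m)%N ->
    h b c d e + h a b d e + h a b c d = h a c d e + h a b c e.
  move=> abc cde em.
  have abcd : cyclic4 (zn a) (zn b) (zn c) (zn d).
    by apply: std_cell_cyclic4 => //; lia.
  have abde : cyclic4 (zn a) (zn b) (zn d) (zn e).
    by apply: std_cell_cyclic4 => //; lia.
  have [bcde cdea bcea] := cross_ratio_five abcd abde (std_cell_cyclic3 zc cde em).
  have := ft _ _ (cross_ratio01 abcd) (cross_ratio01 abde).
  rewrite -bcde -cdea -bcea -/(h a c d e) -/(h a b c e).
  rewrite !gh; [|lia..].
  have regroup (k p q r s t : A) : k - p + (k - q) + s + (k - r) + t =
      k *+ 3 + (s + t - (p + q + r)).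
    have -> : k - p + (k - q) + s + (k - r) + t =
        k - p + (k - q) + (k - r) + (s + t).
      by rewrite [RHS]addrA; congr (_ + t); exact: addrAC.
    rewrite (addrACA k (- p)) (addrACA (k + k)) -[LHS]addrA -!opprD.
    by rewrite [_ + (s + t)]addrC !mulrSr mulr0n add0r.
  rewrite regroup => /eqP; rewrite -subr_eq0 addrAC subrr add0r subr_eq0.
  by move=> /eqP ->; rewrite [LHS]addrC addrA.
rewrite sum_dihedral //.
rewrite (_ : \sum_(0 <= j < m) _ =
    \sum_(0 <= j < m) \sum_(0 <= i < j.-1) (f 1 - h i i.+1 j j.+1)); last first.
  apply: eq_big_nat => j jm; apply: eq_big_nat => i ij.
  by rewrite gh //; lia.
under eq_bigr do rewrite sumrB.
(* By the definition of [h] the last column already reads [h 0 i i.+1 m], and [sum_strips]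
   identifies it with the sum subtracted in the other columns. *)
by rewrite sumrB sum_triangle ?(sum_strips h_cocycle) ?subrK //; lia.
Qed.

(** * Boundary limits of the five-term equation *)

Lemma cvg_within_comp (R : realType) (A : topologicalType) (f : R -> A)
    (T : Type) (F : set_system T) (phi : T -> R) (D : set R) (l : R) :
  Filter F -> {within D, continuous f} -> D l ->
  (\forall t \near F, D (phi t)) -> phi t @[t --> F] --> l ->
  f (phi t) @[t --> F] --> f l.
Proof.
move=> FF /subspace_continuousP fc Dl Dphi phil U /(fc l Dl) Ul.
have := phil _ Ul; rewrite /= !nbhs_simpl /= => H.
by apply: filterS2 Dphi H => t Dt; exact.
Qed.

Lemma cvg_addz (A : topologicalZmodType) (T : Type) (F : set_system T)
    (g h : T -> A) (a b : A) : Filter F ->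
  g t @[t --> F] --> a -> h t @[t --> F] --> b -> g t + h t @[t --> F] --> a + b.
Proof.
by move=> FF ga hb; apply: (cvg_comp2 ga hb); exact: (@add_continuous A (a, b)).
Qed.

Section Limits.

(** The right-hand side is a free constant [c], so that the limits also apply to a function whose
    value at 1 is not yet tied to it. *)
Variables (R : realType) (A : topologicalZmodType) (f : R -> A) (c : A).
Hypothesis A_hausdorff : hausdorff_space A.
Hypothesis f_cont : {within `[0, 1], continuous f}.
Hypothesis f_five : forall x y : R, 0 < x < 1 -> 0 < y < 1 ->
  f x + f ((1 - x) / (1 - x * y)) + f ((1 - y) / (1 - x * y)) + f y
    + f (1 - x * y) = c.

Let near01 : \forall y \near (0 : R)^'+, 0 < y < 1.
Proof.
by near=> y; apply/andP; split; near: y; [exact: nbhs_right_gt|exact: nbhs_right_lt].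
Unshelve. all: by end_near. Qed.

Let id_lim : y @[y --> (0 : R)^'+] --> (0 : R).
Proof. by apply: cvg_at_right_filter; exact: cvg_id. Qed.

Let f_lim (phi : R -> R) (l : R) :
  (forall y, 0 < y < 1 -> 0 <= phi y <= 1) -> 0 <= l <= 1 ->
  phi y @[y --> 0^'+] --> l -> f (phi y) @[y --> 0^'+] --> f l.
Proof.
move=> phi01 l01; apply: (cvg_within_comp _ f_cont); rewrite /= ?in_itv //=.
by near=> y; rewrite in_itv; apply: phi01; near: y.
Unshelve. all: by end_near. Qed.

Let eq_lim (g : R -> A) (l : A) : (forall y, 0 < y < 1 -> g y = c) ->
  g y @[y --> 0^'+] --> l -> l = c.
Proof.
move=> gc gl; apply: (cvg_unique A_hausdorff gl).
apply: (cvg_trans _ (@cvg_cst A c R 0^'+ _)).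
by apply: near_eq_cvg; near=> y; rewrite gc //; near: y.
Unshelve. all: by end_near. Qed.

(** Let [y] tend to 0 from the right: all arguments stay in [[0, 1]], where [f] is continuous, and
    limits in [A] are unique. *)
Lemma five_term_limit0 (x : R) : 0 < x < 1 ->
  f x + f (1 - x) + f 1 + f 0 + f 1 = c.
Proof.
move=> /[dup] x01 /andP[x0 x1].
have xy_lim : 1 - x * y @[y --> 0^'+] --> (1 : R).
  have : 1 - x * y @[y --> 0^'+] --> 1 - x * 0.
    by apply: cvgB; [exact: cvg_cst|apply: cvgM => //; exact: cvg_cst].
  by rewrite mulr0 subr0.
have xy0 y : 0 < y < 1 -> 0 < 1 - x * y.
  by case/andP=> y0 y1; rewrite subr_gt0 mulr_ilt1 // ltW.
have quo_lim (g : R -> R) (l : R) :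
    g y @[y --> 0^'+] --> l -> g y / (1 - x * y) @[y --> 0^'+] --> l.
  move=> gl; have := cvgM gl (cvgV (oner_neq0 R) xy_lim).
  by rewrite invr1 mulr1; apply.
apply: (eq_lim (fun y y01 => f_five x01 y01)).
apply: cvg_addz; [apply: cvg_addz; [apply: cvg_addz; [apply: cvg_addz|]|]|].
- exact: cvg_cst.
- apply: (f_lim (phi := fun y => (1 - x) / (1 - x * y))).
  + move=> y y01; have := xy0 _ y01; case/andP: y01 => y0 y1 d0.
    by rewrite ler_pdivlMr // ler_pdivrMr //; nra.
  + by lra.
  + by apply: (quo_lim (fun=> 1 - x)); exact: cvg_cst.
- apply: (f_lim (phi := fun y => (1 - y) / (1 - x * y))).
  + move=> y y01; have := xy0 _ y01; case/andP: y01 => y0 y1 d0.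
    by rewrite ler_pdivlMr // ler_pdivrMr //; nra.
  + by lra.
  + apply: (quo_lim (fun y => 1 - y)).
    by have := cvgB (cvg_cst (1 : R)) id_lim; rewrite subr0; apply.
- by apply: (f_lim (phi := id)) => // [y|]; lra.
- apply: (f_lim (phi := fun y => 1 - x * y)) => //; last by lra.
  by move=> y y01; have := xy0 _ y01; case/andP: y01 => y0 y1 d0; nra.
Qed.

(** Second limit: [x] tends to 0 in [five_term_limit0]. *)
Lemma five_term_limit00 : f 0 + f 1 + f 1 + f 0 + f 1 = c.
Proof.
apply: (eq_lim five_term_limit0).
do 3![apply: cvg_addz; last exact: cvg_cst].
apply: cvg_addz; first by apply: (f_lim (phi := id)) => // [y|]; lra.
apply: (f_lim (phi := fun y => 1 - y)) => [y||]; try by lra.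
by have := cvgB (cvg_cst (1 : R)) id_lim; rewrite subr0; apply.
Qed.

End Limits.

(** * Continuity of the dilogarithm series on [[0, 1]] *)

Section Li2.

Variable R : realType.
Implicit Types x y : R.

Let S (n : nat) x : R := series (fun k : nat => x ^+ k.+1 / k.+1%:R ^+ 2) n.

Let S_nondecreasing x : 0 <= x -> nondecreasing_seq (S ^~ x).
Proof.
move=> x0; apply/nondecreasing_seqP => n; rewrite /S seriesSr lerDl.
by rewrite divr_ge0 // exprn_ge0.
Qed.

(* From 1 / (k + 1)^2 <= 1 / k - 1 / (k + 1), by telescoping. *)
Let S_tail x n m : 0 <= x <= 1 -> (0 < n <= m)%N ->
  S m x <= S n x + n%:R^-1 - m%:R^-1.
Proof.
move=> /andP[x0 x1] /andP[n0]; elim: m => [|m IH]; first by rewrite leqNgt n0.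
rewrite leq_eqVlt => /predU1P[<-|]; first by rewrite addrK.
rewrite ltnS => nm; have m0 : (0 < m)%N by exact: leq_trans nm.
have := IH nm; rewrite /S seriesSr /= => {}IH.
have xm : x ^+ m.+1 <= 1 by exact: exprn_ile1.
have mp : 0 < m%:R :> R by rewrite ltr0n.
have -> : m.+1%:R = m%:R + 1 :> R by rewrite -natr1.
have : x ^+ m.+1 / (m%:R + 1) ^+ 2 <= m%:R^-1 - (m%:R + 1)^-1.
  have -> : m%:R^-1 - (m%:R + 1)^-1 = (1 + m%:R^-1) / (m%:R + 1) ^+ 2 :> R.
    by field; rewrite !gt_eqF ?addr_gt0.
  rewrite ler_wpM2r ?invr_ge0 ?exprn_ge0 ?addr_ge0 ?ler0n //.
  by rewrite (le_trans xm) // lerDl invr_ge0 ltW.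
by move=> H; have := lerD IH H; rewrite addrC !addrA; lra.
Qed.

Let S_cvg x : 0 <= x <= 1 -> S ^~ x @ \oo --> Li2 x.
Proof.
move=> x01; apply: nondecreasing_is_cvgn.
  by apply: S_nondecreasing; case/andP: x01.
exists (S 1 x + 1) => _ [n _ <-].
case/andP: (x01) => x0 _.
(* The tail estimate needs a positive index, while [n] may be 0. *)
apply: (@le_trans _ _ (S n.+1 x)); first exact: S_nondecreasing.
apply: (le_trans (S_tail (n := 1) x01 _)) => //.
by rewrite invr1 gerBl invr_ge0.
Qed.

(** The tail estimate as [m] tends to infinity. The bound is free of [x], so convergence is
    uniform. *)
Let S_dist x n : 0 <= x <= 1 -> (0 < n)%N -> `|Li2 x - S n x| <= n%:R^-1.
Proof.
move=> x01 n0; have x0 : 0 <= x by case/andP: x01.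
rewrite ger0_norm.
  rewrite lerBlDr; apply: (cvgr_to_le (S_cvg x01)).
  near=> m; apply: (le_trans (S_tail (n := n) x01 _)).
    by rewrite n0 /=; near: m; exact: nbhs_infty_ge.
  by rewrite [leRHS]addrC gerBl invr_ge0.
rewrite subr_ge0; apply: (cvgr_to_ge (S_cvg x01)).
by near=> m; apply: S_nondecreasing => //; near: m; exact: nbhs_infty_ge.
Unshelve. all: by end_near. Qed.

Lemma Li2_0 : Li2 0 = 0 :> R.
Proof.
apply/esym/(cvg_unique (@Rhausdorff R) _ (S_cvg _)); last by rewrite lexx ler01.
apply: (cvg_trans _ (@cvg_cst R 0 nat \oo _)).
apply: near_eq_cvg; near=> n.
by rewrite /S /series /= big1 // => k _; rewrite expr0n mul0r.
Unshelve. all: by end_near. Qed.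

Let S_continuous n : continuous (S n).
Proof.
elim: n => [|n IH] x.
  rewrite (_ : S 0 = fun=> 0); first exact: cvg_cst.
  by apply/funext => y; rewrite /S /series /= big_geq.
rewrite (_ : S n.+1 = fun y => S n y + y ^+ n.+1 / n.+1%:R ^+ 2).
  apply: cvgD; first exact: IH.
  by apply: cvgM; [exact: exprn_continuous|exact: cvg_cst].
by apply/funext => y; rewrite /S seriesSr.
Qed.

(** A uniform limit of polynomials. *)
Lemma Li2_continuous : {within `[0, 1], continuous (@Li2 R)}.
Proof.
apply: (@uniform_limit_continuous_subspace _ _ _ (S @ \oo)).
  by exists 0 => // n _; apply: continuous_subspaceT; exact: S_continuous.
move=> P /uniform_nbhs[E [+ EP]].
rewrite -entourage_ballE => -[e /= e0 eE].
suff : \forall n \near \oo, P (S n) by [].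
near=> n; apply: EP => x; rewrite /= in_itv /= => x01.
apply: eE; rewrite /ball /=.
apply: (le_lt_trans (S_dist (n := n) x01 _)); first by near: n; exact: nbhs_infty_gt.
rewrite invf_plt ?posrE //; near: n; exact: nbhs_infty_gtr.
Unshelve. all: by end_near. Qed.

End Li2.

(** * Continuity of the Rogers dilogarithm on [[0, 1]] *)

Section RogersContinuity.

Variable R : realType.
Implicit Types x y : R.

(** Since [ln 0 = 0] by convention, this vanishes at 0 and 1, in agreement with its limits there. *)
Let lnln x := ln x * ln (1 - x).

(** Apply [ln t < t] to [- ln x = 2 ln (1 / sqrt x)] and [ln (1 + t) <= t] to
    [- ln (1 - x) = ln (1 + x / (1 - x))]; the square root leaves a factor tending to 0. *)
Let lnln_bound x : 0 < x < 1 -> `|lnln x| <= 2 * Num.sqrt x / (1 - x).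
Proof.
move=> /andP[x0 x1].
have y0 : 0 < 1 - x by lra.
have s0 : 0 < Num.sqrt x by rewrite sqrtr_gt0.
have lx : - ln x <= 2 * (Num.sqrt x)^-1.
  rewrite -lnV ?posrE // -{1}(sqr_sqrtr (ltW x0)) -exprVn lnXn ?invr_gt0 //.
  by rewrite -[leLHS]mulr_natl ler_pM2l // ltW // ln_sublinear // invr_gt0.
have ly : - ln (1 - x) <= x / (1 - x).
  rewrite -lnV ?posrE // [X in ln X](_ : _ = 1 + x / (1 - x)); last by field; rewrite gt_eqF.
  apply: le_ln1Dx.
  by apply: (@lt_le_trans _ _ 0); rewrite ?ltrN10 // divr_ge0 ?ltW.
have nx : 0 <= - ln x by rewrite oppr_ge0 ln_le0 // ltW.
have ny : 0 <= - ln (1 - x) by rewrite oppr_ge0 ln_le0 //; lra.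
rewrite /lnln -(mulrNN (ln x)) ger0_norm ?mulr_ge0 //.
apply: (le_trans (ler_pM nx ny lx ly)).
rewrite -{2}(sqr_sqrtr (ltW x0)) le_eqVlt; apply/orP; left; apply/eqP.
by field; rewrite !gt_eqF.
Qed.

Let lnln_cvg0 : lnln x @[x --> within `[0, 1] (nbhs (0 : R))] --> (0 : R).
Proof.
have sq : 2 * Num.sqrt x / (1 - x) @[x --> (0 : R)] --> (0 : R).
  have /= := cvgM (cvgM (cvg_cst (2 : R)) (@sqrt_continuous R 0))
    (cvgV (_ : 1 - 0 != 0 :> R) (cvgB (cvg_cst (1 : R)) (@cvg_id _ (nbhs (0 : R))))).
  by rewrite sqrtr0 mulr0 mul0r subr0; apply; exact: oner_neq0.
apply/cvgr0Pnorm_le => e e0.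
move/cvgr0Pnorm_le: sq => /(_ _ e0) sq.
rewrite near_withinE; near=> x; rewrite /= in_itv /= => /andP[].
rewrite le_eqVlt => /predU1P[<- _|x0 _]; first by rewrite /lnln ln0 // mul0r normr0 ltW.
apply: (le_trans (lnln_bound _)).
  by rewrite x0 /=; near: x; exact: lt_nbhsl.
by apply: (le_trans (ler_norm _)); near: x.
Unshelve. all: by end_near. Qed.

Lemma lnln_continuous : {within `[0, 1], continuous (fun x => ln x * ln (1 - x))}.
Proof.
suff H x : `[0, 1]%classic x -> lnln y @[y --> within `[0, 1] (nbhs x)] --> lnln x.
  by apply/subspace_continuousP => x; exact: H.
rewrite /= in_itv /= => /andP[].
rewrite !le_eqVlt => /predU1P[<- _|x0].
  by rewrite {2}/lnln ln0 // mul0r; exact: lnln_cvg0.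
move=> /predU1P[->|x1].
  rewrite {2}/lnln subrr [ln 0]ln0 // mulr0.
  (* The symmetry [x -> 1 - x] carries the end point 1 to 0. *)
  have -> : lnln = lnln \o (fun x => 1 - x).
    by apply/funext => y; rewrite /lnln /= subKr mulrC.
  apply: cvg_comp lnln_cvg0 => U /= [e /= e0 eU].
  exists e => // y /= ye; rewrite in_itv /= => y01; apply: eU => /=.
    by rewrite sub0r opprB distrC.
  by rewrite in_itv /=; lra.
apply: (cvg_trans (cvg_app _ (cvg_within _))).
apply: cvgM; first exact: continuous_ln.
apply: (@continuous_comp _ _ _ (fun x => 1 - x) (@ln R)).
  by apply: cvgB; [exact: cvg_cst|exact: cvg_id].
by apply: continuous_ln; lra.
Qed.

(** The formula without prescribed end values; it can differ from [rogersL] only at 1. *)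
Let L x := Li2 x + 2^-1 * (ln x * ln (1 - x)).

Let L_continuous : {within `[0, 1], continuous L}.
Proof.
apply/subspace_continuousP => x x01.
apply: cvgD; first by move/subspace_continuousP: (@Li2_continuous R); apply.
apply: cvgM; first exact: cvg_cst.
by move/subspace_continuousP: lnln_continuous; apply.
Qed.

Let rogersLE x : x != 1 -> rogersL x = L x.
Proof.
move=> x1; rewrite /rogersL (negbTE x1) /L; case: eqVneq => // ->.
by rewrite Li2_0 ln0 // mul0r mulr0 addr0.
Qed.

(* The five-term equation itself forces pi^2 / 6 to be the limit of L at 1. *)
Lemma five_term_rogersL_continuous :
  five_term (@rogersL R) -> {within `[0, 1], continuous (@rogersL R)}.
Proof.
move=> ft.
have L0 : L 0 = 0 by rewrite /L Li2_0 ln0 // mul0r mulr0 addr0.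
have L1 : L 1 = rogersL 1.
  (* As [L 0 = 0], this says [3 L 1 = 3 rogersL 1]. The five-term equation passes from [rogersL] to
     [L] because its five arguments are all less than 1. *)
  suff : L 0 + L 1 + L 1 + L 0 + L 1 = rogersL 1 *+ 3.
    by rewrite L0 -mulr_natr; move: (L 1) (rogersL 1) => l l'; lra.
  apply: (five_term_limit00 (@Rhausdorff R) L_continuous).
  move=> x y x01 y01; rewrite -(ft x y x01 y01).
  have [/andP[x0 x1] /andP[y0 y1]] := (x01, y01).
  have xy0 : 0 < x * y by exact: mulr_gt0.
  have xyx : x * y < x by rewrite gtr_pMr.
  have xyy : x * y < y by rewrite gtr_pMl.
  have d0 : 0 < 1 - x * y by lra.
  rewrite !rogersLE // lt_eqF // ?ltr_pdivrMr //; lra.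
rewrite (_ : @rogersL R = L) //; apply/funext => x.
by have [->|/rogersLE] := eqVneq x 1.
Qed.

End RogersContinuity.

(** * Reflection equation and conclusion *)

Lemma reflection_of_five_term (R : realType) (A : topologicalZmodType) (f : R -> A) :
  hausdorff_space A -> {within `[0, 1], continuous f} -> f 0 = 0 -> five_term f ->
  forall x, 0 < x < 1 -> f x + f (1 - x) = f 1.
Proof.
move=> hA fc f0 ft x /(five_term_limit0 hA fc ft).
move=> /(congr1 (fun t => t - f 1 - f 1)).
by rewrite f0 addr0 !mulrSr mulr0n add0r !addrK.
Qed.

Lemma dilog_eq_of_eq5 (R : realType) (n : nat) : (4 <= n)%N -> deduced_from_Eq5 R n.
Proof.
case: n => // m m2 A f hA fc f0 /dilog_eq5P ft.
apply: dilog_eq_of_five_term => //; exact: reflection_of_five_term.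
Qed.

Theorem mainTheorem2 (R : realType) :
  (forall (A : zmodType) (f : R -> A), dilog_eq 5 f <-> five_term f) /\
  (forall n : nat, (4 <= n)%N -> n <> 5%N ->
    deduced_from_Eq5 R n /\ (dilog_eq 5 (@rogersL R) -> dilog_eq n (@rogersL R))).
Proof.
split=> [A f|n n4 _]; first exact: dilog_eq5P.
split=> [|L5]; first exact: dilog_eq_of_eq5.
have /five_term_rogersL_continuous Lc := (dilog_eq5P _).1 L5.
apply: (@dilog_eq_of_eq5 R n n4 R); [exact: Rhausdorff|exact: Lc| |exact: L5].
by rewrite /rogersL eqxx.
Qed.
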